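(* Let $T$ be a twice differentiable, periodic planar path with translation symmetry. Then there exists a threshold $N\in\mathbb{N}$ such that for every integer $n\geq N$, the path $T$ admits a period-$n$ trajectoid.
   Context: A twice differentiable periodic path $T$ with translation symmetry is a planar curve in $P=\mathbb{R}^2\cong\mathbb{R}^2\times\{0\}\subset\mathbb{R}^3$ given by a twice differentiable arclength parametrization $\gamma:\mathbb{R}\to\mathbb{R}^2$ (so $|\gamma'|\equiv 1$) for which there are $L>0$ and a nonzero vector $v\in\mathbb{R}^2$ with $\gamma(s+L)=\gamma(s)+v$ for all $s$. One period of $T$ is $T^\star=\gamma|_{[0,L]}$, a curve of length $L$. For $K>0$, let a sphere $S_K$ of radius $K^{-1}$ and center $O$ roll on the plane $P$ without slip (zero velocity of the contact point) and without spin (zero normal component of the angular velocity) so that the contact point in $P$ follows $T$. The contact point then traces a curve $T_K$ on the sphere (in the frame fixed to the sphere); it has the same geodesic curvature, as a function of arclength, as the planar curvature $k(s)$ of $T$, and is unique up to isometry. Explicitly, with $e_3=(0,0,1)$ and $\gamma'(s)$ regarded as a vector of $\mathbb{R}^3$, let $\omega(s)=K\,e_3\times\gamma'(s)$, let $A:\mathbb{R}\to SO(3)$ solve $A'(s)w=\omega(s)\times(A(s)w)$ for all $w\in\mathbb{R}^3$, $A(0)=I$; then $T_K$ is the curve $\sigma_K(s)=-K^{-1}A(s)^{T}e_3$ on the sphere of radius $K^{-1}$ centered at the origin. The part of $T_K$ corresponding to one period $T^\star$ is $T_K^\star=\sigma_K|_{[0,L]}$. For a positive integer $n$, the path $T$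 admits a period-$n$ trajectoid if there exists $K>0$ such that $T_K$ is a closed curve consisting of $n$ full periods $T_K^\star$, i.e. $\sigma_K(s+nL)=\sigma_K(s)$ for all $s\in\mathbb{R}$. The trajectoid (of radius $K^{-1}$) is then the convex set obtained as the intersection, over all points of $T_K$, of the half-spaces that contain $S_K$ and whose boundary planes are tangent to $S_K$ at those points; it rolls along $T$ on $P$ without slip or spin together with the sphere. *)

(* Defs.v *)
From HB Require Import structures.
From mathcomp Require Import all_boot all_order all_algebra.
From mathcomp Require Import all_classical all_reals all_analysis.

Set Implicit Arguments.
Unset Strict Implicit.
Unset Printing Implicit Defensive.

Import Order.TTheory GRing.Theory Num.Theory.
Import numFieldNormedType.Exports.

Local Open Scope ring_scope.

(* Pitfall: the canonical norm `|x| on 'cV[R]_n is the sup norm, so arclength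
   needs the Euclidean norm.  Differentiability in 'cV[R]_n and 'M[R]_n does
   not depend on that choice, and is taken for the library's topology. *)
Definition enorm (R : realType) (n : nat) (x : 'cV[R]_n) : R :=
  Num.sqrt (\sum_(i < n) x i 0 ^+ 2).

Definition crossp (R : realType) (x y : 'cV[R]_3) : 'cV[R]_3 :=
  let a : 'I_3 := inord 0 in
  let b : 'I_3 := inord 1 in
  let c : 'I_3 := inord 2 in
  \col_(i < 3)
    (if i == a then x b 0 * y c 0 - x c 0 * y b 0
     else if i == b then x c 0 * y a 0 - x a 0 * y c 0
     else x a 0 * y b 0 - x b 0 * y a 0).

Definition e3 (R : realType) : 'cV[R]_3 := delta_mx ord_max 0.

Definition embed_plane (R : realType) (x : 'cV[R]_2) : 'cV[R]_3 :=
  col_mx x (0 : 'cV[R]_1).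

Definition is_rotation (R : realType) (M : 'M[R]_3) : Prop :=
  M^T *m M = 1%:M /\ \det M = 1.

(* The second derivative is only required to exist, not to be continuous. *)
Definition twice_differentiable_path (R : realType)
    (gamma : R -> 'cV[R]_2) : Prop :=
  (forall s : R, derivable gamma s 1) /\
  (forall s : R, derivable (derive1 gamma) s 1).

Definition arclength_parametrized (R : realType)
    (gamma : R -> 'cV[R]_2) : Prop :=
  forall s : R, enorm (derive1 gamma s) = 1.

(* L is a period, not necessarily the smallest one. *)
Definition translation_symmetric (R : realType) (gamma : R -> 'cV[R]_2)
    (L : R) (v : 'cV[R]_2) : Prop :=
  [/\ 0 < L, v != 0 & forall s : R, gamma (s + L) = gamma s + v].

Definition periodic_path (R : realType) (gamma : R -> 'cV[R]_2)
    (L : R) (v : 'cV[R]_2) : Prop :=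
  [/\ twice_differentiable_path gamma,
      arclength_parametrized gamma
    & translation_symmetric gamma L v].

Definition rolling_velocity (R : realType) (gamma : R -> 'cV[R]_2) (K s : R) :
    'cV[R]_3 :=
  K *: crossp (e3 R) (embed_plane (derive1 gamma s)).

Definition rolling_motion (R : realType) (gamma : R -> 'cV[R]_2) (K : R)
    (A : R -> 'M[R]_3) : Prop :=
  [/\ forall s : R, is_rotation (A s),
      forall s : R, derivable A s 1,
      forall (s : R) (w : 'cV[R]_3),
        derive1 A s *m w = crossp (rolling_velocity gamma K s) (A s *m w)
    & A 0 = 1%:M].

(* The contact point, at -K^-1 e3 from the centre of the sphere, expressed in
   the frame fixed to the sphere: A s maps that frame to the fixed frame and
   (A s)^T is its inverse. *)
Definition sphere_trace (R : realType) (K : R) (A : R -> 'M[R]_3) (s : R) :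
    'cV[R]_3 :=
  - (K^-1 *: ((A s)^T *m e3 R)).

(* The rolling motion A is uniquely determined by gamma and K, so asking for
   some A amounts to speaking about the rolling motion. *)
Definition admits_trajectoid (R : realType) (gamma : R -> 'cV[R]_2) (L : R)
    (n : nat) : Prop :=
  (0 < n)%N /\
  exists2 K : R, 0 < K &
    exists2 A : R -> 'M[R]_3, rolling_motion gamma K A &
      forall s : R, sphere_trace K A (s + n%:R * L) = sphere_trace K A s.

(* Main.v *)
(* The rolling motion is lifted to unit quaternions: if the angular velocity is
   omega, it is [w |-> q w q^-1] where [q' = omega q / 2] and [q 0 = 1].
   Periodicity of omega gives [q (s + L) = q s * q L], so [q (s + n L) = - q s]
   as soon as [q L] has real part [cos (pi / n)], and [q] and [- q] are the same
   rotation.  The real part of [q L] depends continuously on [K], is 1 at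
   [K = 0], and is smaller than 1 for some small [K > 0] because to first order
   in [K] the imaginary part of [q L] is [K / 2] times the translation vector
   turned by a right angle.  The intermediate value theorem then reaches
   [cos (pi / n)] for all large [n]. *)

Require Import Defs.
From mathcomp Require Import all_boot all_order all_algebra.
From mathcomp Require Import all_classical all_reals all_analysis.
From mathcomp Require Import ring lra.

Set Implicit Arguments.
Unset Strict Implicit.
Unset Printing Implicit Defensive.

Import Order.TTheory GRing.Theory Num.Theory.
Import numFieldNormedType.Exports.

Local Open Scope classical_set_scope.
Local Open Scope ring_scope.

(** * One-variable calculus: mean value estimates, primitives, limits of derivatives *)

Lemma derive_continuous (R : realType) (f df : R -> R) :
  (forall x : R, is_derive x (1 : R) f (df x)) -> continuous f.
Proof.
move=> fd x; apply: differentiable_continuous.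
by apply/derivable1_diffP; exact: (@ex_derive _ _ _ _ _ _ _ (fd x)).
Qed.

Lemma is_derive_reflect (R : realType) (f : R -> R) (x a : R) :
  is_derive (- x) (1 : R) f a ->
  is_derive x (1 : R) (fun u => f (- u)) (- a).
Proof.
move=> fd; have -> : - a = a * - 1 by rewrite mulrN1.
exact: (@is_derive1_comp _ f -%R x).
Qed.

Lemma derive_le_lipschitz (R : realType) (f df : R -> R) (x y M : R) :
  (forall t : R, is_derive t (1 : R) f (df t)) ->
  (forall t : R, `|t - x| <= `|y - x| -> `|df t| <= M) ->
  `|f y - f x| <= M * `|y - x|.
Proof.
move=> fd fM; have fc := derive_continuous fd.
have [xy|/ltW yx] := leP x y.
  have [c /[!in_itv]/= /andP[xc cy] ->] :=
    MVT_segment xy (fun t _ => fd t) (continuous_subspaceT fc).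
  rewrite normrM ler_wpM2r// fM// !ger0_norm ?subr_ge0//.
  by rewrite lerB.
have [c /[!in_itv]/= /andP[yc cx] e] :=
  MVT_segment yx (fun t _ => fd t) (continuous_subspaceT fc).
rewrite distrC e normrM (distrC y) ler_wpM2r// fM//.
by rewrite distrC (distrC y) !ger0_norm ?subr_ge0// lerB.
Qed.

(** The factor [1 / (k + 1)] gained here at each integration is what puts the factorials into the
    Picard estimate. For [s >= 0], the function [M * s ^+ k.+1 / k.+1%:R - f s] is nondecreasing and
    vanishes at 0. *)
Lemma derive_le_power (R : realType) (f df : R -> R) (M : R) (k : nat) :
  (forall t : R, is_derive t (1 : R) f (df t)) -> f 0 = 0 ->
  (forall t : R, `|df t| <= M * `|t| ^+ k) ->
  forall s : R, `|f s| <= M * `|s| ^+ k.+1 / k.+1%:R.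
Proof.
(* An upper bound on the half-line [0 <= s] suffices: it is applied to [f], to [- f] and to the
   reflections of both in the origin. *)
suff pos (g dg : R -> R) : (forall t : R, is_derive t (1 : R) g (dg t)) ->
    g 0 = 0 -> (forall t : R, `|dg t| <= M * `|t| ^+ k) ->
    forall s : R, 0 <= s -> g s <= M * s ^+ k.+1 / k.+1%:R.
  move=> fd f0 fM s.
  have nd (g dg : R -> R) : (forall t : R, is_derive t (1 : R) g (dg t)) ->
      forall t : R, is_derive t (1 : R) (fun u => g (- u)) (- dg (- t)).
    by move=> gd t; exact: is_derive_reflect.
  have od (g dg : R -> R) : (forall t : R, is_derive t (1 : R) g (dg t)) ->
      forall t : R, is_derive t (1 : R) (fun u => - g u) (- dg t).
    by move=> gd t; exact: is_deriveN.
  have [s0|/ltW s0] := leP 0 s.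
    rewrite ler_norml lerNl ?(ger0_norm s0); apply/andP; split.
      apply: (pos _ _ (od _ _ fd)) => //; first by rewrite f0 oppr0.
      by move=> t; rewrite normrN.
    exact: (pos _ _ fd).
  have s1 : 0 <= - s by rewrite oppr_ge0.
  rewrite (ler0_norm s0) ler_norml lerNl -{1 3}[s]opprK; apply/andP; split.
    apply: (pos _ _ (nd _ _ (od _ _ fd))) => //=; first by rewrite oppr0 f0 oppr0.
    by move=> t; rewrite !normrN -(normrN t).
  apply: (pos _ _ (nd _ _ fd)) => //=; first by rewrite oppr0 f0.
  by move=> t; rewrite normrN -(normrN t).
move=> gd g0 gM s s0.
pose h := fun t => M * t ^+ k.+1 / k.+1%:R - g t.
have hd (t : R) : is_derive t (1 : R) h (M * t ^+ k - dg t).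
  have := gd t => {}gd.
  pose c := M / k.+1%:R.
  have -> : h = c *: (id ^+ k.+1 : R -> R) - g.
    by apply/funext => u; rewrite /h/c !fctE /GRing.scale/=; ring.
  apply: is_derive_eq; rewrite /=.
  rewrite /c /GRing.scale/= !mulr1 mulrnAl -mulr_natr; congr (_ - _).
  by field.
have : h 0 <= h s.
  apply: (@ger0_derive1_ndecr _ h 0 s) => //.
  - move=> x; rewrite in_itv/= => /andP[/ltW x0 _].
    rewrite derive1E; case: (hd x) => _ ->.
    rewrite subr_ge0 (le_trans (ler_norm _))//.
    by rewrite (le_trans (gM x))// ger0_norm.
  - by apply: continuous_subspaceT; exact: derive_continuous hd.
by rewrite /h g0 expr0n/= mulr0 mul0r subr0 subr_ge0.
Qed.

Lemma continuous_antiderivative (R : realType) (f : R -> R) :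
  continuous f ->
  exists F : R -> R, F 0 = 0 /\ forall x : R, is_derive x (1 : R) F (f x).
Proof.
move=> cf.
pose mu := @lebesgue_measure R.
(* Freezing [f] on one side of 0 makes the Lebesgue integral over a half-line
   converge. *)
have half (g : R -> R) : continuous g -> exists G : R -> R,
    forall x : R, is_derive x (1 : R) G (g (Num.max x 0) - g 0).
  move=> cg; pose h := fun x => g (Num.max x 0) - g 0.
  have ch : continuous h.
    move=> x; apply: continuousB; last exact: cst_continuous.
    apply: (@continuous_comp _ _ _ (fun y : R => Num.max y 0) g); last exact: cg.
    by apply: continuous_max; [exact: cvg_id|exact: cvg_cst].
  have hint (u : R) : mu.-integrable [set` `]-oo, u]] (EFin \o h).
    rewrite integrable_mkcond//=.
    have -> : (EFin \o h) \_ `]-oo, u] = (EFin \o h) \_ `[0, u].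
      apply/funext => x; rewrite !patchE.
      have [x0|x0] := leP 0 x.
        by rewrite !mem_setE !in_itv/= x0.
      rewrite !mem_setE !in_itv/= [in RHS]leNgt x0/=.
      case: ifP => // _; rewrite /h /Num.max x0 subrr//.
    rewrite -integrable_mkcond//=.
    apply: continuous_compact_integrable; first exact: segment_compact.
    exact: continuous_subspaceT.
  exists (fun x => \int[mu]_(t in [set` `]-oo, x]]) h t)%R => x.
  have [|||d e] := @continuous_FTC1 R h -oo%O x (x + 1) _ (hint _).
  - by rewrite ltrDl.
  - by rewrite ltNyr.
  - exact: ch.
  by apply: DeriveDef; rewrite -?derive1E.
have [G Gd] := half f cf.
have [|H Hd] := half (fun x => f (- x)).
  move=> x; apply: (@continuous_comp _ _ _ -%R f); last exact: cf.
  exact: opp_continuous.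
(* The term [G x] has derivative [f x - f 0] on the right of 0 and 0 on the left, [- H (- x)]
   behaves the other way round, and the linear term restores the constant [f 0]. *)
pose F := fun x => f 0 * x + G x - H (- x).
exists (fun x => F x - F 0); split; first by rewrite subrr.
move=> x; have := Gd x; have := Hd (- x) => {}Hd {}Gd.
have Hd' : is_derive x (1 : R) (fun x => H (- x))
    (- (f (- Num.max (- x) 0) - f (- 0))).
  exact: is_derive_reflect.
have -> : (fun x => F x - F 0) =
    (f 0 *: id : R -> R) + G - (fun x => H (- x)) - cst (F 0).
  by apply/funext => t; rewrite /F !fctE.
apply: is_derive_eq.
rewrite !oppr0 addr0 /GRing.scale/= mulr1 opprK.
have [x0|x0] := leP 0 x.
  have -> : Num.max (- x) 0 = 0 by apply/max_idPr; rewrite oppr_le0.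
  by rewrite oppr0; ring.
have -> : Num.max (- x) 0 = - x by apply/max_idPl; rewrite oppr_ge0 ltW.
by rewrite opprK; ring.
Qed.

(** For [k >= N] the derivative of [f k - f N] is at most [e / 2] within distance [r] of [x]. The
    resulting mean value bound survives the limit in [k], so the difference quotients of [F] and
    [f N] differ by at most [e / 2], whatever the increment. The distances from the quotient of
    [f N] to [g N x] and from [g N x] to [G x] cost [e / 4] each. *)
Lemma derive_uniform_limit (R : realType) (f g : nat -> R -> R) (F G : R -> R)
    (x r : R) : 0 < r ->
  (forall k (y : R), is_derive y (1 : R) (f k) (g k y)) ->
  (forall y : R, f k y @[k --> \oo] --> F y) ->
  (forall e : R, 0 < e -> \forall k \near \oo,
     forall y : R, `|y - x| <= r -> `|g k y - G y| <= e) ->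
  is_derive x (1 : R) F (G x).
Proof.
move=> r0 fd fF gG.
suff dF : h^-1 *: (F (h *: 1 + x) - F x) @[h --> 0^'] --> G x.
  by apply: DeriveDef; [apply/cvg_ex; exists (G x)|apply/cvg_lim].
apply/cvgrPdist_le => e e0.
have e4 : 0 < e / 4 by rewrite divr_gt0.
have [N _ HN] := gG _ e4.
have NG := HN N (leqnn N).
have incr (y : R) : `|y - x| <= r ->
    `|(F y - F x) - (f N y - f N x)| <= e / 2 * `|y - x|.
  move=> yr.
  have lim : (f k y - f k x) - (f N y - f N x) @[k --> \oo] -->
      (F y - F x) - (f N y - f N x).
    by apply: cvgB; [apply: cvgB; exact: fF|exact: cvg_cst].
  apply: cvgr_to_le (cvg_norm lim) _.
  exists N => // k /= Nk.
  have -> : (f k y - f k x) - (f N y - f N x) = (f k - f N) y - (f k - f N) x.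
    by rewrite !fctE; ring.
  apply: (@derive_le_lipschitz _ _ (g k - g N)).
  move=> t tr; have tr' := le_trans tr yr.
  have := HN k Nk t tr'; have := NG t tr'.
  have -> : (g k - g N) t = g k t - g N t by [].
  by rewrite !ler_norml => /andP[? ?] /andP[? ?]; apply/andP; split; lra.
have fN : h^-1 *: (f N (h *: 1 + x) - f N x) @[h --> 0^'] --> g N x.
  have [/cvg_ex[l lP] dv] := fd N x.
  by rewrite -dv /derive (cvg_lim _ lP).
move/cvgrPdist_le : fN => /(_ _ e4) fN.
near=> h.
have h0 : h != 0 by near: h; exact: nbhs_dnbhs_neq.
have hr : `|h| <= r by near: h; exact: dnbhs0_le.
have A1 : `|g N x - h^-1 *: (f N (h *: 1 + x) - f N x)| <= e / 4.
  by near: h; exact: fN.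
have A2 : `|h^-1 * ((F (h + x) - F x) - (f N (h + x) - f N x))| <= e / 2.
  rewrite normrM normfV ler_pdivrMl ?normr_gt0// mulrC.
  by have := incr (h + x); rewrite addrK; apply.
have := NG x; rewrite subrr normr0 => /(_ (ltW r0)) A3.
move: A1; rewrite /GRing.scale/= mulr1 => A1.
rewrite mulrBr in A2; move: A1 A2 A3; rewrite !ler_norml.
set u := h^-1 * (F _ - _); set w := h^-1 * (f N _ - _).
move=> /andP[? ?] /andP[? ?] /andP[? ?]; apply/andP; split; lra.
Unshelve. all: by end_near. Qed.

(** * Series of functions and linear differential equations *)

(** The Weierstrass M-test. A block of consecutive terms is bounded by the same block of [series e],
    independently of [t]; letting the upper end of the block go to infinity bounds the remainder
    uniformly on [A]. *)
Lemma weierstrass_series (R : realType) (T : Type) (A : set T)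
    (f : nat -> T -> R) (e : nat -> R) :
  (forall k t, A t -> `|f k t| <= e k) -> cvgn (series e) ->
  (forall t, A t -> cvgn (series (f ^~ t))) /\
  (forall d : R, 0 < d -> \forall N \near \oo, forall t, A t ->
     `|series (f ^~ t) N - limn (series (f ^~ t))| <= d).
Proof.
move=> fe ce.
have cf t : A t -> cvgn (series (f ^~ t)).
  move=> At; apply: normed_cvg; apply: (series_le_cvg _ _ _ ce) => [k|k|k] /=.
  - exact: normr_ge0.
  - exact: le_trans (fe k t At).
  - exact: fe.
split => // d d0.
have /cauchy_cvgP/cauchy_seriesP/(_ _ d0) := ce => -[[P Q] /= [P1 Q1] PQ].
near=> N => t At.
have PN : P N by near: N.
have lim : series (f ^~ t) N - series (f ^~ t) k @[k --> \oo] -->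
   series (f ^~ t) N - limn (series (f ^~ t)).
  by apply: cvgB; [exact: cvg_cst|exact: cf].
apply: cvgr_to_le (cvg_norm lim) _.
near=> k.
have Nk : (N <= k)%N by near: k; exists N.
have Qk : Q k by near: k.
have /= := PQ (N, k) (conj PN Qk).
rewrite distrC sub_series_geq// => /ltW; apply: le_trans.
rewrite (le_trans (ler_norm_sum _ _ _))// (le_trans _ (ler_norm _))//.
by apply: ler_sum => i _; exact: fe.
Unshelve. all: by end_near. Qed.

(** The Picard term of index [k] is at most [D * (c * |s|) ^ k / k!], so on every bounded interval
    the series of these terms is dominated by an exponential series and may be differentiated term
    by term. *)
Lemma linear_ode_exists (R : realType) (n : nat) (m : 'I_n -> 'I_n -> R -> R)
    (M : R) (y0 : 'I_n -> R) :
  (forall i j, continuous (m i j)) -> (forall i j s, `|m i j s| <= M) ->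
  exists y : 'I_n -> R -> R, (forall i, y i 0 = y0 i) /\
    forall i s, is_derive s (1 : R) (y i) (\sum_j m i j s * y j s).
Proof.
move=> mc mM.
(* A total primitive operator, so that the Picard scheme is a plain [iter]. Its value at a
   discontinuous function is arbitrary and is never met, since all iterates are continuous. *)
have [|prim primP] := @choice (R -> R) (R -> R) (fun f F => continuous f ->
    F 0 = 0 /\ forall x, is_derive x (1 : R) F (f x)).
  move=> f; have [/continuous_antiderivative[F FP]|nf] := pselect (continuous f).
    by exists F.
  by exists f.
pose rhs (b : 'I_n -> R -> R) i s := \sum_j m i j s * b j s.
(* Picard iterates: the solution is the sum of the [B k]. *)
pose B k := iter k (fun b i => prim (rhs b i)) (fun i => cst (y0 i)).
have rhsc b : (forall i, continuous (b i)) -> forall i, continuous (rhs b i).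
  move=> bc i; apply: continuous_big => [|j _ s]; first exact: add_continuous.
  by apply: cvgM; [exact: mc|exact: bc].
have Bc k : forall i, continuous (B k i).
  elim: k => [|k ih] i; first exact: cst_continuous.
  exact: derive_continuous (primP _ (rhsc _ ih i)).2.
have Bd k i s : is_derive s (1 : R) (B k.+1 i) (rhs (B k) i s).
  exact: (primP _ (rhsc _ (Bc k) i)).2.
have B0 k i : B k.+1 i 0 = 0 by exact: (primP _ (rhsc _ (Bc k) i)).1.
pose c := n%:R * M; pose D : R := \sum_i `|y0 i|.
have Bb k : forall i s, `|B k i s| <= D * c ^+ k / k`!%:R * `|s| ^+ k.
  elim: k => [|k ih] i s.
    rewrite /= /cst !expr0 !mulr1 divr1 /D (bigD1 i)//= lerDl.
    by apply: sumr_ge0.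
  apply: le_trans (derive_le_power (M := D * c ^+ k.+1 / k`!%:R)
    (Bd k i) (B0 k i) _ s) _; last first.
    rewrite factS natrM invfM le_eqVlt; apply/orP; left; apply/eqP; ring.
  move=> t; rewrite (le_trans (ler_norm_sum _ _ _))//.
  have -> : D * c ^+ k.+1 / k`!%:R * `|t| ^+ k =
      \sum_(j < n) M * (D * c ^+ k / k`!%:R * `|t| ^+ k).
    by rewrite sumr_const card_ord -mulr_natl exprS /c; ring.
  apply: ler_sum => j _; rewrite normrM.
  by apply: ler_pM.
(* For [n = 0] the bound on the entries says nothing about the sign of [M], and the empty family is
   a solution. *)
case: (posnP n) => [n0|n_gt0].
  by exists (fun=> cst 0); split=> -[i iln]; exfalso; rewrite n0 in iln.
have M0 : 0 <= M by exact: le_trans (mM (Ordinal n_gt0) (Ordinal n_gt0) 0).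
have c0 : 0 <= c by rewrite mulr_ge0.
have D0 : 0 <= D by exact: sumr_ge0.
pose e (T : R) k := D * exp_coeff (c * T) k.
have ce T : cvgn (series (e T)).
  exact: (@is_cvg_seriesZ _ _ D (is_cvg_series_exp_coeff (c * T))).
have Be T i k s : `|s| <= T -> `|B k i s| <= e T k.
  move=> sT; rewrite (le_trans (Bb k i s))//.
  have -> : e T k = D * c ^+ k / k`!%:R * T ^+ k.
    by rewrite /e /exp_coeff/= exprMn_comm; [ring|exact: mulrC].
  rewrite ler_wpM2l ?divr_ge0 ?mulr_ge0 ?exprn_ge0//.
  by rewrite lerXn2r ?nnegrE// (le_trans _ sT).
pose y i s := limn (series (fun k => B k i s)).
have W T i := @weierstrass_series R R [set s | `|s| <= T] (fun k => B k i) _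
  (fun k s => @Be T i k s) (ce T).
exists y; split=> [i|i x].
  (* At 0 only the term of index 0 survives, so the partial sums are constant from index 1 on. *)
  apply/cvg_lim => //; apply: cvg_near_cst; exists 1%N => // k /= k0.
  rewrite /series/= big_ltn// big_nat_cond big1 ?addr0// => j /andP[/andP[j0 _] _].
  by rewrite -(prednK j0) B0.
(* The shift is essential: differentiating the sum of [N.+1] terms kills the constant [B 0] and
   gives the right-hand side at the sum of [N] terms. *)
apply: (@derive_uniform_limit R (fun N s => series (fun k => B k i s) N.+1)
  (fun N s => rhs (fun j s => series (fun k => B k j s) N) i s)
  (y i) (rhs y i) x 1) => //.
- elim=> [|N ih] s.
    rewrite [X in is_derive _ _ X](_ : _ = B 0%N i); last first.
      by apply/funext => t; rewrite /series/= big_nat1.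
    rewrite [X in is_derive _ _ _ X](_ : _ = 0); first exact: is_derive_cst.
    by rewrite /rhs big1// => j _; rewrite /series/= big_geq// mulr0.
  rewrite [X in is_derive _ _ X](_ : _ =
      (fun s => series (fun k => B k i s) N.+1) + B N.+1 i); last first.
    by apply/funext => t; rewrite seriesSr.
  have ? := ih s; have ? := Bd N i s; apply: is_derive_eq.
  rewrite /rhs -big_split/=; apply: eq_bigr => j _.
  by rewrite -mulrDr seriesSr.
- move=> s; have := (W `|s| i).1 s (lexx _).
  by rewrite -(cvg_shiftS (series _)).
- move=> d d0.
  (* The denominator is [c + 1] because [c] may be 0. The error [d / (c + 1)] in each coordinate
     becomes at most [c * (d / (c + 1)) <= d] in the right-hand side. *)
  have d1 : 0 < d / (c + 1) by rewrite divr_gt0// ltr_wpDl.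
  have : \forall N \near \oo, forall j s, `|s| <= `|x| + 1 ->
      `|series (fun k => B k j s) N - y j s| <= d / (c + 1).
    apply: filter_forall => j.
    exact: (W (`|x| + 1) j).2.
  apply: filterS => N H s sx.
  have sx1 : `|s| <= `|x| + 1.
    by rewrite -(subrK x s) addrC (le_trans (ler_normD _ _))// lerD2l.
  rewrite /rhs -sumrB (le_trans (ler_norm_sum _ _ _))//.
  apply: (@le_trans _ _ (\sum_(j < n) M * (d / (c + 1)))).
    apply: ler_sum => j _; rewrite -mulrBr normrM.
    by apply: ler_pM => //; exact: H.
  rewrite sumr_const card_ord -mulr_natl mulrA -/c mulrCA ler_piMr// ?(ltW d0)//.
  by rewrite ler_pdivrMr ?ltr_wpDl// mul1r lerDl.
Qed.

(** * Quaternions and the spinor equation *)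

Record quaternion (R : Type) := Quaternion { q0 : R; q1 : R; q2 : R; q3 : R }.

Definition quat1 (R : realType) : quaternion R := Quaternion 1 0 0 0.

Definition quat_mul (R : realType) (x y : quaternion R) : quaternion R :=
  Quaternion
    (q0 x * q0 y - q1 x * q1 y - q2 x * q2 y - q3 x * q3 y)
    (q0 x * q1 y + q1 x * q0 y + q2 x * q3 y - q3 x * q2 y)
    (q0 x * q2 y - q1 x * q3 y + q2 x * q0 y + q3 x * q1 y)
    (q0 x * q3 y + q1 x * q2 y - q2 x * q1 y + q3 x * q0 y).

Definition quat_dot (R : realType) (x y : quaternion R) : R :=
  q0 x * q0 y + q1 x * q1 y + q2 x * q2 y + q3 x * q3 y.

(* [q' = K (p i + r j) q]: the angular velocity is twice [K (p i + r j)]. *)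
Definition spinor_motion (R : realType) (K : R) (p r : R -> R)
    (q : R -> quaternion R) : Prop :=
  [/\ forall s : R, is_derive s (1 : R) (fun t => q0 (q t))
        (- K * (p s * q1 (q s) + r s * q2 (q s))),
      forall s : R, is_derive s (1 : R) (fun t => q1 (q t))
        (K * (p s * q0 (q s) + r s * q3 (q s))),
      forall s : R, is_derive s (1 : R) (fun t => q2 (q t))
        (K * (r s * q0 (q s) - p s * q3 (q s)))
    & forall s : R, is_derive s (1 : R) (fun t => q3 (q t))
        (K * (p s * q2 (q s) - r s * q1 (q s)))].

Lemma spinor_motion_exists (R : realType) (K : R) (p r : R -> R) :
  continuous p -> continuous r ->
  (forall s, `|p s| <= 1) -> (forall s, `|r s| <= 1) ->
  exists2 q : R -> quaternion R, spinor_motion K p r q & q 0 = quat1 R.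
Proof.
move=> pc rc p1 r1.
(* The matrix of left multiplication by [K (p i + r j)] in the basis 1, i, j, k. *)
pose m (i j : 'I_4) s := K * nth 0 (nth [::] [:: [:: 0; - p s; - r s; 0];
  [:: p s; 0; 0; r s]; [:: r s; 0; 0; - p s]; [:: 0; - r s; p s; 0]] i) j.
have [||y [y0 yd]] := @linear_ode_exists R 4 m `|K| (fun i => (i == ord0)%:R).
- have Kc (f : R -> R) : continuous f -> continuous (fun s => K * f s).
    by move=> fc s; apply: cvgM; [exact: cvg_cst|exact: fc].
  have Nc (f : R -> R) : continuous f -> continuous (fun s => - f s).
    by move=> fc s; apply: cvgN; exact: fc.
  have Zc : continuous (fun _ : R => 0 : R) by exact: cst_continuous.
  move=> [i ilt] [j jlt]; rewrite /m /=; apply: Kc.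
  move: i ilt j jlt => [|[|[|[|//]]]] _ [|[|[|[|//]]]] _ //=; exact: Nc.
- move=> [i ilt] [j jlt] s; rewrite /m /= normrM ler_piMr//.
  by move: i ilt j jlt => [|[|[|[|//]]]] _ [|[|[|[|//]]]] _ //=;
    rewrite ?normr0 ?normrN.
pose z k := y (inord k).
have yz i : y i = z i by rewrite /z inord_val.
have zd (k : nat) s : (k < 4)%N ->
    is_derive s (1 : R) (z k) (\sum_j m (inord k) j s * z j s).
  by move=> k4; have := yd (inord k) s; under eq_bigr do rewrite yz.
have z0 (k : nat) : (k < 4)%N -> z k 0 = (k == 0%N)%:R.
  by move=> k4; rewrite /z y0 -val_eqE/= inordK.
exists (fun s => Quaternion (z 0%N s) (z 1%N s) (z 2%N s) (z 3%N s)).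
  have eqd (f : R -> R) (s a b : R) :
    is_derive s (1 : R) f a -> a = b -> is_derive s (1 : R) f b by move=> ? <-.
  split=> s /=; [apply: eqd (zd 0%N s isT) _|apply: eqd (zd 1%N s isT) _|
    apply: eqd (zd 2%N s isT) _|apply: eqd (zd 3%N s isT) _];
  by rewrite !big_ord_recl big_ord0 /m /= inordK//= /bump/=; ring.
by rewrite !z0.
Qed.

(* Left multiplication by an imaginary quaternion is skew, so only [K - K']
   survives. *)
Lemma spinor_motion_dot (R : realType) (K K' : R) (p r : R -> R)
    (x y : R -> quaternion R) (s : R) :
  spinor_motion K p r x -> spinor_motion K' p r y ->
  is_derive s (1 : R) (fun t => quat_dot (x t) (y t))
    ((K - K') * (- (p s * q1 (x s) + r s * q2 (x s)) * q0 (y s) +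
      (p s * q0 (x s) + r s * q3 (x s)) * q1 (y s) +
      (r s * q0 (x s) - p s * q3 (x s)) * q2 (y s) +
      (p s * q2 (x s) - r s * q1 (x s)) * q3 (y s))).
Proof.
move=> [/(_ s) a0 /(_ s) a1 /(_ s) a2 /(_ s) a3].
move=> [/(_ s) b0 /(_ s) b1 /(_ s) b2 /(_ s) b3].
have := is_deriveD (is_deriveD (is_deriveD (is_deriveM a0 b0)
  (is_deriveM a1 b1)) (is_deriveM a2 b2)) (is_deriveM a3 b3).
move=> {a0 a1 a2 a3 b0 b1 b2 b3} ?.
rewrite (_ : (fun t => _) =
    (fun t => q0 (x t)) * (fun t => q0 (y t)) +
    (fun t => q1 (x t)) * (fun t => q1 (y t)) +
    (fun t => q2 (x t)) * (fun t => q2 (y t)) +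
    (fun t => q3 (x t)) * (fun t => q3 (y t))); last by apply/funext.
by apply: is_derive_eq; rewrite /GRing.scale/=; ring.
Qed.

Lemma spinor_motion_dot_cst (R : realType) (K : R) (p r : R -> R)
    (x y : R -> quaternion R) (s : R) :
  spinor_motion K p r x -> spinor_motion K p r y ->
  quat_dot (x s) (y s) = quat_dot (x 0) (y 0).
Proof.
move=> xm ym; apply: (@is_derive_0_is_cst _ (fun t => quat_dot (x t) (y t))) => t.
by have := spinor_motion_dot t xm ym; rewrite subrr mul0r.
Qed.

Lemma quat_dot_dist (R : realType) (x y : quaternion R) :
  quat_dot x x - 2 * quat_dot x y + quat_dot y y = (q0 x - q0 y) ^+ 2 +
    (q1 x - q1 y) ^+ 2 + (q2 x - q2 y) ^+ 2 + (q3 x - q3 y) ^+ 2.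
Proof. by rewrite /quat_dot; ring. Qed.

(** The squared distance between two solutions is a combination of three conserved dot products, so
    it keeps its initial value 0. *)
Lemma spinor_motion_unique (R : realType) (K : R) (p r : R -> R)
    (x y : R -> quaternion R) :
  spinor_motion K p r x -> spinor_motion K p r y -> x 0 = y 0 -> x =1 y.
Proof.
move=> xm ym xy s.
have : quat_dot (x s) (x s) - 2 * quat_dot (x s) (y s) + quat_dot (y s) (y s) = 0.
  rewrite (spinor_motion_dot_cst _ xm xm) (spinor_motion_dot_cst _ xm ym).
  by rewrite (spinor_motion_dot_cst _ ym ym) xy; ring.
rewrite quat_dot_dist => /eqP; rewrite !paddr_eq0 ?addr_ge0 ?sqr_ge0//.
rewrite !sqrf_eq0 !subr_eq0.
case: (x s) (y s) => [? ? ? ?] [? ? ? ?] /=.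
by move=> /andP[/andP[/andP[]]] /eqP-> /eqP-> /eqP-> /eqP->.
Qed.

(** The coefficient of the equation acts on the left, hence commutes with multiplication by a
    constant on the right. *)
Lemma spinor_motion_mulr (R : realType) (K : R) (p r : R -> R)
    (x : R -> quaternion R) (g : quaternion R) :
  spinor_motion K p r x -> spinor_motion K p r (fun s => quat_mul (x s) g).
Proof.
move=> [d0 d1 d2 d3].
have lin (c0 c1 c2 c3 s e : R) :
    e = - K * (p s * q1 (x s) + r s * q2 (x s)) * c0 +
        K * (p s * q0 (x s) + r s * q3 (x s)) * c1 +
        K * (r s * q0 (x s) - p s * q3 (x s)) * c2 +
        K * (p s * q2 (x s) - r s * q1 (x s)) * c3 ->
    is_derive s (1 : R) (fun t => q0 (x t) * c0 + q1 (x t) * c1 +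
      q2 (x t) * c2 + q3 (x t) * c3) e.
  move=> ->; have ? := d0 s; have ? := d1 s; have ? := d2 s; have ? := d3 s.
  rewrite (_ : (fun t => _) =
    c0 \*: (fun t => q0 (x t)) + c1 \*: (fun t => q1 (x t)) +
    c2 \*: (fun t => q2 (x t)) + c3 \*: (fun t => q3 (x t))); last first.
    by apply/funext => t; congr (_ + _ + _ + _); exact: mulrC.
  by apply: is_derive_eq; rewrite /GRing.scale/=; ring.
split=> s /=.
- rewrite [X in is_derive _ _ X](_ : _ = fun t => q0 (x t) * q0 g +
    q1 (x t) * - q1 g + q2 (x t) * - q2 g + q3 (x t) * - q3 g).
    by apply: lin; ring.
  by apply/funext => t; ring.
- rewrite [X in is_derive _ _ X](_ : _ = fun t => q0 (x t) * q1 g +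
    q1 (x t) * q0 g + q2 (x t) * q3 g + q3 (x t) * - q2 g).
    by apply: lin; ring.
  by apply/funext => t; ring.
- rewrite [X in is_derive _ _ X](_ : _ = fun t => q0 (x t) * q2 g +
    q1 (x t) * - q3 g + q2 (x t) * q0 g + q3 (x t) * q1 g).
    by apply: lin; ring.
  by apply/funext => t; ring.
- rewrite [X in is_derive _ _ X](_ : _ = fun t => q0 (x t) * q3 g +
    q1 (x t) * q2 g + q2 (x t) * - q1 g + q3 (x t) * q0 g).
    by apply: lin; ring.
  by apply/funext => t; ring.
Qed.

(** * Periodic coefficients: monodromy and the half turn *)

Lemma is_derive_translate (R : realType) (f : R -> R) (x c a : R) :
  is_derive (x + c) (1 : R) f a -> is_derive x (1 : R) (fun t => f (t + c)) a.
Proof.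
move=> fd; have -> : a = a * 1 by rewrite mulr1.
have ? : is_derive x (1 : R) (fun t : R => t + c) (1 : R).
  rewrite (_ : (fun t => _) = id + cst c); last by apply/funext.
  by apply: is_derive_eq; rewrite addr0.
exact: (@is_derive1_comp _ f (fun t => t + c) x).
Qed.

Lemma spinor_motion_translate (R : realType) (K : R) (p r : R -> R) (L : R)
    (x : R -> quaternion R) :
  (forall s, p (s + L) = p s) -> (forall s, r (s + L) = r s) ->
  spinor_motion K p r x -> spinor_motion K p r (fun s => x (s + L)).
Proof.
move=> pL rL [d0 d1 d2 d3]; split=> s /=; rewrite -(pL s) -(rL s).
- exact: (@is_derive_translate _ (fun t => q0 (x t))).
- exact: (@is_derive_translate _ (fun t => q1 (x t))).
- exact: (@is_derive_translate _ (fun t => q2 (x t))).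
- exact: (@is_derive_translate _ (fun t => q3 (x t))).
Qed.

(** Both sides solve the same equation and agree at 0, where [x 0] is the unit. *)
Lemma spinor_motion_monodromy (R : realType) (K : R) (p r : R -> R) (L : R)
    (x : R -> quaternion R) :
  (forall s, p (s + L) = p s) -> (forall s, r (s + L) = r s) ->
  spinor_motion K p r x -> x 0 = quat1 R ->
  forall s, x (s + L) = quat_mul (x s) (x L).
Proof.
move=> pL rL xm x0.
apply: (spinor_motion_unique (spinor_motion_translate pL rL xm)
  (spinor_motion_mulr _ xm)).
rewrite add0r x0; case: (x L) => ? ? ? ?; rewrite /quat_mul/=.
by congr Quaternion; ring.
Qed.

(* Cayley-Hamilton for a unit quaternion of real part [cos phi] gives a
   recurrence solved by Chebyshev polynomials of the second kind. *)
Lemma recurrence_half_turn (R : realType) (u : nat -> R) (phi : R) (n : nat) :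
  (forall m, u m.+2 = 2 * cos phi * u m.+1 - u m) ->
  sin phi != 0 -> n%:R * phi = pi -> u n = - u 0%N.
Proof.
move=> ur phi0 nphi.
(* The closed form is [sin phi * u m = w m]. The angle [(m - 1) phi] is written as a difference of
   reals so that [m = 0] is covered. When [n * phi = pi], the first sine vanishes and the second is
   [sin phi]. *)
pose w m := sin (m%:R * phi) * u 1%N - sin (m%:R * phi - phi) * u 0%N.
have H m : sin phi * u m = w m /\ sin phi * u m.+1 = w m.+1.
  elim: m => [|m [ih1 ih2]].
    by rewrite /w !mul0r !mul1r sin0 subrr sub0r sinN sin0; split; ring.
  split=> //; rewrite ur mulrBr mulrCA ih2 ih1 /w.
  have -> : m.+2%:R * phi = m.+1%:R * phi + phi by rewrite -[in LHS]natr1; ring.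
  have -> : m%:R * phi = m.+1%:R * phi - phi by rewrite -[in RHS]natr1; ring.
  rewrite addrK; set t := m.+1%:R * phi.
  rewrite !sinD !sinN !cosN !cosD !sinN !cosN; have := cos2Dsin2 phi.
  set c := cos phi; set d := sin phi => e.
  have {}e : d ^+ 2 = 1 - c ^+ 2 by rewrite -e; ring.
  ring: e.
have [+ _] := H n; rewrite /w nphi sinpi sinB sinpi cospi mul0r.
rewrite mul0r !sub0r mulN1r opprK => e.
by apply: (mulfI phi0); rewrite e mulrN.
Qed.

Definition quat_opp (R : realType) (x : quaternion R) : quaternion R :=
  Quaternion (- q0 x) (- q1 x) (- q2 x) (- q3 x).

(** The monodromy [g = x L] has norm 1 and real part [cos phi], hence [g ^ 2 = 2 cos phi * g - 1].
    So each coordinate of [x (s + m L) = x s * g ^ m] obeys the recurrence above in [m]. *)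
Lemma spinor_motion_period (R : realType) (K : R) (p r : R -> R) (L phi : R)
    (n : nat) (x : R -> quaternion R) :
  (forall s, p (s + L) = p s) -> (forall s, r (s + L) = r s) ->
  spinor_motion K p r x -> x 0 = quat1 R ->
  q0 (x L) = cos phi -> sin phi != 0 -> n%:R * phi = pi ->
  forall s, x (s + n%:R * L) = quat_opp (x s).
Proof.
move=> pL rL xm x0 xL phi0 nphi s.
have mono := spinor_motion_monodromy pL rL xm x0.
have g1 : quat_dot (x L) (x L) = 1.
  by rewrite (spinor_motion_dot_cst _ xm xm) x0 /quat_dot/=; ring.
have step m : x (s + m.+1%:R * L) = quat_mul (x (s + m%:R * L)) (x L).
  by rewrite -mono; congr x; rewrite -natr1; ring.
have rec m :
    x (s + m.+2%:R * L) = quat_mul (quat_mul (x (s + m%:R * L)) (x L)) (x L).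
  by rewrite !step.
have half (f : quaternion R -> R) :
    (forall h, f (quat_mul (quat_mul h (x L)) (x L)) =
      2 * cos phi * f (quat_mul h (x L)) - f h) ->
    f (x (s + n%:R * L)) = - f (x s).
  move=> fh.
  have -> : x s = x (s + 0%N%:R * L) by rewrite mul0r addr0.
  apply: (@recurrence_half_turn R (fun m => f (x (s + m%:R * L))) phi) => // m.
  by rewrite rec fh -step.
have e : q3 (x L) * q3 (x L) = 1 - q0 (x L) * q0 (x L) - q1 (x L) * q1 (x L)
   - q2 (x L) * q2 (x L) by rewrite -g1 /quat_dot; ring.
have [h0 h1 h2 h3] : [/\ q0 (x (s + n%:R * L)) = - q0 (x s),
    q1 (x (s + n%:R * L)) = - q1 (x s), q2 (x (s + n%:R * L)) = - q2 (x s)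
  & q3 (x (s + n%:R * L)) = - q3 (x s)].
  by split; apply: half => h; rewrite -xL /quat_mul/=; ring: e.
by rewrite /quat_opp -h0 -h1 -h2 -h3; case: (x (s + _)).
Qed.

(** * Dependence of the solution on [K], and its expansion for small [K] *)

Lemma unit_quaternion_le1 (R : realType) (x : quaternion R) : quat_dot x x = 1 ->
  [/\ `|q0 x| <= 1, `|q1 x| <= 1, `|q2 x| <= 1 & `|q3 x| <= 1].
Proof.
rewrite /quat_dot => e; have := sqr_ge0 (q0 x); have := sqr_ge0 (q1 x).
have := sqr_ge0 (q2 x); have := sqr_ge0 (q3 x) => h3 h2 h1 h0.
have le1 (t : R) : t ^+ 2 <= 1 -> `|t| <= 1.
  by rewrite -[`|t| <= 1](@ler_sqr R) ?nnegrE// expr1n real_normK// num_real.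
by split; apply: le1; lra.
Qed.

Lemma spinor_motion_unit (R : realType) (K : R) (p r : R -> R)
    (x : R -> quaternion R) :
  spinor_motion K p r x -> x 0 = quat1 R -> forall s, quat_dot (x s) (x s) = 1.
Proof.
by move=> xm x0 s; rewrite (spinor_motion_dot_cst _ xm xm) x0 /quat_dot/=; ring.
Qed.

(** For unit quaternions the squared distance is 2 minus twice the dot product. The derivative of
    the dot product is [K - K'] times a sum of eight products of factors bounded by 1, whence the
    constant 16. *)
Lemma spinor_motion_close (R : realType) (K K' : R) (p r : R -> R)
    (x y : R -> quaternion R) (s : R) :
  (forall s, `|p s| <= 1) -> (forall s, `|r s| <= 1) ->
  spinor_motion K p r x -> spinor_motion K' p r y ->
  x 0 = quat1 R -> y 0 = quat1 R ->
  (q0 (x s) - q0 (y s)) ^+ 2 + (q1 (x s) - q1 (y s)) ^+ 2 +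
    (q2 (x s) - q2 (y s)) ^+ 2 + (q3 (x s) - q3 (y s)) ^+ 2 <=
  16 * `|K - K'| * `|s|.
Proof.
move=> p1 r1 xm ym x0 y0.
have x1 := spinor_motion_unit xm x0; have y1 := spinor_motion_unit ym y0.
have M3 (u v w : R) : `|u| <= 1 -> `|v| <= 1 -> `|w| <= 1 ->
    - 1 <= u * v * w <= 1.
  move=> u1 v1 w1; rewrite -ler_norml !normrM -[1]mulr1.
  by rewrite ler_pM ?mulr_ge0// -[1]mulr1 ler_pM.
have dotE t : `|t - 0| <= `|s - 0| ->
    `|(K - K') * (- (p t * q1 (x t) + r t * q2 (x t)) * q0 (y t) +
      (p t * q0 (x t) + r t * q3 (x t)) * q1 (y t) +
      (r t * q0 (x t) - p t * q3 (x t)) * q2 (y t) +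
      (p t * q2 (x t) - r t * q1 (x t)) * q3 (y t))| <= 8 * `|K - K'|.
  move=> _; rewrite normrM mulrC ler_wpM2r//.
  have [a0 a1 a2 a3] := unit_quaternion_le1 (x1 t).
  have [b0 b1 b2 b3] := unit_quaternion_le1 (y1 t).
  have /andP[? ?] := M3 _ _ _ (p1 t) a1 b0.
  have /andP[? ?] := M3 _ _ _ (r1 t) a2 b0.
  have /andP[? ?] := M3 _ _ _ (p1 t) a0 b1.
  have /andP[? ?] := M3 _ _ _ (r1 t) a3 b1.
  have /andP[? ?] := M3 _ _ _ (r1 t) a0 b2.
  have /andP[? ?] := M3 _ _ _ (p1 t) a3 b2.
  have /andP[? ?] := M3 _ _ _ (p1 t) a2 b3.
  have /andP[? ?] := M3 _ _ _ (r1 t) a1 b3.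
  by rewrite ler_norml; apply/andP; split; lra.
have := derive_le_lipschitz (fun t => spinor_motion_dot t xm ym) dotE.
rewrite /= subr0 x0 y0 ler_norml => /andP[+ _].
have -> : quat_dot (quat1 R) (quat1 R) = 1 by rewrite /quat_dot/=; ring.
by rewrite -quat_dot_dist x1 y1 => H; lra.
Qed.

Lemma spinor_motion0 (R : realType) (p r : R -> R) :
  spinor_motion 0 p r (fun=> quat1 R).
Proof. by split=> s; rewrite ?oppr0 mul0r; exact: is_derive_cst. Qed.

(** Comparison with the constant solution at [K = 0]: the condition on [d] keeps [q0] within [d] of
    1 and [q3] within [d] of 0 over the period. The derivatives of [q1 - K P] and [q2 - K Q] are
    then at most [2 K d]. *)
Lemma spinor_motion_first_order (R : realType) (K L d : R) (p r P Q : R -> R)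
    (x : R -> quaternion R) :
  (forall s, `|p s| <= 1) -> (forall s, `|r s| <= 1) ->
  (forall s, is_derive s (1 : R) P (p s)) ->
  (forall s, is_derive s (1 : R) Q (r s)) ->
  spinor_motion K p r x -> x 0 = quat1 R ->
  0 <= K -> 0 <= L -> 0 <= d -> 16 * K * L <= d ^+ 2 ->
  `|q1 (x L) - K * (P L - P 0)| <= K * (d * 2) * L /\
  `|q2 (x L) - K * (Q L - Q 0)| <= K * (d * 2) * L.
Proof.
move=> p1 r1 Pd Qd xm x0 K0 L0 d0 KLd.
have small t : `|t| <= L -> `|q0 (x t) - 1| <= d /\ `|q3 (x t)| <= d.
  move=> tL; have := spinor_motion_close t p1 r1 xm (spinor_motion0 p r) x0 erefl.
  rewrite /= !subr0 (ger0_norm K0) => H.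
  have {}H := le_trans (le_trans H (ler_wpM2l (mulr_ge0 _ K0) tL)) KLd.
  have led (u : R) : u ^+ 2 <= d ^+ 2 -> `|u| <= d.
    by rewrite -[`|u| <= d](@ler_sqr R) ?nnegrE// real_normK// num_real.
  have := sqr_ge0 (q0 (x t) - 1); have := sqr_ge0 (q1 (x t)).
  have := sqr_ge0 (q2 (x t)); have := sqr_ge0 (q3 (x t)) => h3 h2 h1 h0.
  by have {}H := H (ler0n _ _); split; apply: led; lra.
have M2 (u v : R) : `|u| <= 1 -> `|v| <= d -> - d <= u * v <= d.
  move=> u1 v1; rewrite -ler_norml normrM -[leRHS]mul1r.
  by rewrite ler_pM.
case: (xm) => _ m1 m2 _; split.
- have fd (s : R) : is_derive s (1 : R) (fun t => q1 (x t) - K * P t)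
      (K * (p s * (q0 (x s) - 1) + r s * q3 (x s))).
    have ? := m1 s; have ? := Pd s.
    rewrite (_ : (fun t => _) = (fun t => q1 (x t)) - K \*: P); last by apply/funext.
    by apply: is_derive_eq; rewrite /GRing.scale/=; ring.
  have := derive_le_lipschitz fd (x := 0) (y := L) (M := K * (d * 2)).
  rewrite !subr0 x0 /= (ger0_norm L0) => H.
  apply: le_trans (H _); last first => [t tL|].
    rewrite subr0 in tL; rewrite normrM (ger0_norm K0) ler_wpM2l//.
    have [s0 s3] := small t tL.
    have /andP[? ?] := M2 _ _ (p1 t) s0; have /andP[? ?] := M2 _ _ (r1 t) s3.
    by rewrite ler_norml; apply/andP; split; lra.
  by rewrite le_eqVlt; apply/orP; left; apply/eqP; congr `|_|; ring.
- have fd (s : R) : is_derive s (1 : R) (fun t => q2 (x t) - K * Q t)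
      (K * (r s * (q0 (x s) - 1) - p s * q3 (x s))).
    have ? := m2 s; have ? := Qd s.
    rewrite (_ : (fun t => _) = (fun t => q2 (x t)) - K \*: Q); last by apply/funext.
    by apply: is_derive_eq; rewrite /GRing.scale/=; ring.
  have := derive_le_lipschitz fd (x := 0) (y := L) (M := K * (d * 2)).
  rewrite !subr0 x0 /= (ger0_norm L0) => H.
  apply: le_trans (H _); last first => [t tL|].
    rewrite subr0 in tL; rewrite normrM (ger0_norm K0) ler_wpM2l//.
    have [s0 s3] := small t tL.
    have /andP[? ?] := M2 _ _ (r1 t) s0; have /andP[? ?] := M2 _ _ (p1 t) s3.
    by rewrite ler_norml; apply/andP; split; lra.
  by rewrite le_eqVlt; apply/orP; left; apply/eqP; congr `|_|; ring.
Qed.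

Lemma spinor_motion_nontrivial (R : realType) (L : R) (p r P Q : R -> R) :
  (forall s, `|p s| <= 1) -> (forall s, `|r s| <= 1) ->
  (forall s, is_derive s (1 : R) P (p s)) ->
  (forall s, is_derive s (1 : R) Q (r s)) ->
  0 < L -> (P L, Q L) != (P 0, Q 0) ->
  exists2 K : R, 0 < K & forall x, spinor_motion K p r x -> x 0 = quat1 R ->
    q0 (x L) < 1.
Proof.
move=> p1 r1 Pd Qd L0 PQ.
pose w : R := `|P L - P 0| + `|Q L - Q 0|.
have w0 : 0 < w.
  rewrite lt_def addr_ge0// andbT paddr_eq0// !normr_eq0 !subr_eq0.
  by move: PQ; rewrite xpair_eqE.
(* Real part 1 forces [q1 = q2 = 0]; after division by [K] the two first-order bounds then add up to
   [w <= 4 d L], which is [w / 2], a contradiction. *)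
have [d d0 dw] : exists2 d : R, 0 < d & d * L * 8 = w.
  exists (w / (8 * L)); first by rewrite divr_gt0// mulr_gt0.
  by field; rewrite gt_eqF.
have [K K0 KL] : exists2 K : R, 0 < K & 16 * K * L <= d ^+ 2.
  exists (d ^+ 2 / (16 * L)); first by rewrite divr_gt0 ?exprn_gt0// mulr_gt0.
  by rewrite le_eqVlt; apply/orP; left; apply/eqP; field; rewrite gt_eqF.
exists K => // x xm x0.
have [H1 H2] := spinor_motion_first_order p1 r1 Pd Qd xm x0
  (ltW K0) (ltW L0) (ltW d0) KL.
rewrite ltNge; apply/negP => ge1.
have x1 := spinor_motion_unit xm x0 L.
have [/(le_trans (ler_norm _)) le1 _ _ _] := unit_quaternion_le1 x1.
have e0 : q0 (x L) = 1 by apply/eqP; rewrite eq_le le1.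
move: x1; rewrite /quat_dot e0 mulr1 -!addrA => /eqP.
rewrite -subr_eq0 addrAC subrr add0r -!expr2 !paddr_eq0 ?addr_ge0 ?sqr_ge0//.
rewrite !sqrf_eq0 => /andP[/eqP e1 /andP[/eqP e2 _]].
move: H1 H2; rewrite e1 e2 !sub0r !normrN !normrM (gtr0_norm K0) -!mulrA.
rewrite !ler_pM2l// => H1 H2.
by move: dw w0; rewrite /w => dw w0; lra.
Qed.

(** * Prescribing the real part of the monodromy *)

Lemma cos_pi_div_near (R : realType) (c : R) : c < 1 ->
  \forall n \near \oo, c <= cos (pi / n%:R).
Proof.
move=> c1.
have cn : cos (pi / n.+1%:R : R) @[n --> \oo] --> (1 : R).
  rewrite -[X in _ --> X]cos0; apply: continuous_cvg; first exact: continuous_cos.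
  by rewrite -[X in _ --> X](mulr0 pi); apply: cvgMr; exact: cvg_harmonic.
have : \forall n \near \oo, c <= cos (pi / n.+1%:R : R) by exact: (cvgr_ge _ cn).
move=> [N _ HN]; exists N.+1 => // -[//|n] /= Nn.
exact: HN.
Qed.

Lemma spinor_motion_angle (R : realType) (L : R) (p r P Q : R -> R) :
  continuous p -> continuous r ->
  (forall s, `|p s| <= 1) -> (forall s, `|r s| <= 1) ->
  (forall s, is_derive s (1 : R) P (p s)) ->
  (forall s, is_derive s (1 : R) Q (r s)) ->
  0 < L -> (P L, Q L) != (P 0, Q 0) ->
  \forall n \near \oo, exists2 K : R, 0 < K & exists2 x, spinor_motion K p r x &
    x 0 = quat1 R /\ q0 (x L) = cos (pi / n%:R).
Proof.
move=> pc rc p1 r1 Pd Qd L0 PQ.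
have [K1 K10 Kx] := spinor_motion_nontrivial p1 r1 Pd Qd L0 PQ.
have [|x xP] := @choice R (R -> quaternion R)
    (fun K x => spinor_motion K p r x /\ x 0 = quat1 R).
  by move=> K; have [x ? ?] := spinor_motion_exists K pc rc p1 r1; exists x.
pose f K := q0 (x K L).
have f0 : f 0 = 1.
  by rewrite /f (spinor_motion_unique (xP 0).1 (spinor_motion0 p r))// (xP 0).2.
have fc : continuous f.
  move=> K; apply/cvgrPdist_le => e e0.
  (* The closeness estimate controls the square of the distance, hence a radius quadratic in [e]. *)
  have d0 : 0 < e ^+ 2 / (16 * L) by rewrite divr_gt0 ?exprn_gt0// mulr_gt0.
  near=> K'.
  have KK : `|K - K'| <= e ^+ 2 / (16 * L).
    by near: K'; exact: cvgr_dist_le.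
  rewrite -[_ <= e](@ler_sqr R) ?nnegrE ?(ltW e0)// real_normK ?num_real//.
  have := spinor_motion_close L p1 r1 (xP K).1 (xP K').1 (xP K).2 (xP K').2.
  rewrite (gtr0_norm L0) => H; rewrite /f.
  apply: (@le_trans _ _ (16 * `|K - K'| * L)).
    apply: le_trans H; rewrite -!addrA lerDl.
    by rewrite !addr_ge0 ?sqr_ge0.
  by rewrite mulrAC mulrC -ler_pdivlMr ?mulr_gt0.
have f1 : f K1 < 1 by apply: Kx; [exact: (xP K1).1|exact: (xP K1).2].
near=> n.
have n2 : (2 <= n)%N by near: n; exists 2%N.
have [K] : exists2 K, K \in `[0, K1] & f K = cos (pi / n%:R).
  apply: IVT; [exact: ltW|exact: continuous_subspaceT|].
  rewrite f0 min_r ?max_l ?(ltW f1)// cos_le1 andbT.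
  by near: n; exact: cos_pi_div_near.
rewrite in_itv/= => /andP[K0 _] fK.
exists K; last by exists (x K); [exact: (xP K).1|split=> //; exact: (xP K).2].
(* The value [K = 0] would give [cos (pi / n) = 1], hence [sin (pi / n) = 0], which fails for
   [n >= 2]. *)
rewrite lt_def K0 andbT; apply/eqP => Ke.
have sin0 : 0 < sin (pi / n%:R : R).
  apply: sin_gt0_pi; rewrite divr_gt0 ?pi_gt0 ?ltr0n ?(ltn_trans _ n2)//=.
  by rewrite ltr_pdivrMr ?ltr0n ?(ltn_trans _ n2)// ltr_pMr ?pi_gt0// ltr1n.
have := cos2Dsin2 (pi / n%:R : R).
rewrite -fK Ke f0 expr1n => /eqP; rewrite -subr_eq0 addrAC subrr add0r.
by rewrite sqrf_eq0 gt_eqF.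
Unshelve. all: by end_near. Qed.

(** * From unit quaternions to rotation matrices and the rolling motion *)

(** The Euler-Rodrigues matrix, which for a unit quaternion is conjugation on imaginary
    quaternions. *)
Definition rotation_mx (R : realType) (x : quaternion R) : 'M[R]_3 :=
  let a := q0 x in let b := q1 x in let c := q2 x in let d := q3 x in
  \matrix_(i, j) nth 0 (nth [::]
    [:: [:: a * a + b * b - c * c - d * d; 2 * (b * c - a * d); 2 * (b * d + a * c)];
        [:: 2 * (b * c + a * d); a * a - b * b + c * c - d * d; 2 * (c * d - a * b)];
        [:: 2 * (b * d - a * c); 2 * (c * d + a * b); a * a - b * b - c * c + d * d]]
    i) j.

Lemma rotation_mx_quat1 (R : realType) : rotation_mx (quat1 R) = 1%:M.
Proof.
apply/matrixP => -[i ilt] [j jlt]; rewrite !mxE -val_eqE /=.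
by move: i ilt j jlt => [|[|[|//]]] _ [|[|[|//]]] _ //=; ring.
Qed.

Lemma rotation_mx_opp (R : realType) (x : quaternion R) :
  rotation_mx (quat_opp x) = rotation_mx x.
Proof. by apply/matrixP => i j; rewrite !mxE /= !mulrNN. Qed.

Lemma rotation_mx_is_rotation (R : realType) (x : quaternion R) :
  quat_dot x x = 1 -> is_rotation (rotation_mx x).
Proof.
case: x => a b c d; rewrite /quat_dot/= => e.
have e' : d * d = 1 - a * a - b * b - c * c by rewrite -e; ring.
split.
  apply/matrixP => -[i ilt] [j jlt].
  rewrite !mxE -val_eqE !big_ord_recl big_ord0 !mxE /= /bump/=.
  by move: i ilt j jlt => [|[|[|//]]] _ [|[|[|//]]] _ //=; ring: e'.
rewrite (expand_det_row _ ord0) !big_ord_recl big_ord0 /cofactor.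
rewrite !(expand_det_row _ (@ord0 1)) !big_ord_recl !big_ord0 /cofactor !det_mx11.
by rewrite !mxE /= /bump/=; ring: e'.
Qed.

(** The list holds the coordinates of the cross product of the angular velocity [2 K (p, r, 0)] with
    column [j]. *)
Lemma rotation_mx_derive (R : realType) (K : R) (p r : R -> R)
    (x : R -> quaternion R) (s : R) (i j : 'I_3) :
  spinor_motion K p r x ->
  is_derive s (1 : R) (fun t => rotation_mx (x t) i j)
    (nth 0 [:: 2 * K * r s * rotation_mx (x s) (inord 2) j;
               - (2 * K * p s * rotation_mx (x s) (inord 2) j);
               2 * K * (p s * rotation_mx (x s) (inord 1) j -
                        r s * rotation_mx (x s) (inord 0) j)] i).
Proof.
move=> [/(_ s) da /(_ s) db /(_ s) dc /(_ s) dd].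
(* Hiding [is_derive], a class, keeps instance search from guessing the
   derivative in the [eapply] below. *)
pose ider (f : R -> R) (f' : R) : Prop := is_derive s (1 : R) f f'.
have dM (f g : R -> R) (f' g' : R) :
    ider f f' -> ider g g' -> ider (fun t => f t * g t) (f s * g' + g s * f').
  by rewrite /ider => ? ?; exact: is_deriveM.
have dD (f g : R -> R) (f' g' : R) :
    ider f f' -> ider g g' -> ider (fun t => f t + g t) (f' + g').
  by rewrite /ider => ? ?; exact: is_deriveD.
have dN (f : R -> R) (f' : R) : ider f f' -> ider (fun t => - f t) (- f').
  by rewrite /ider => ?; exact: is_deriveN.
have d2 : ider (fun _ : R => 2 : R) 0 by exact: is_derive_cst.
have eqd (f : R -> R) (u v : R) : ider f u -> u = v -> is_derive s (1 : R) f v.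
  by move=> ? <-.
rewrite [X in is_derive _ _ X](_ : _ = fun t =>
  let a := q0 (x t) in let b := q1 (x t) in let c := q2 (x t) in
  let d := q3 (x t) in nth 0 (nth [::]
    [:: [:: a * a + b * b - c * c - d * d; 2 * (b * c - a * d); 2 * (b * d + a * c)];
        [:: 2 * (b * c + a * d); a * a - b * b + c * c - d * d; 2 * (c * d - a * b)];
        [:: 2 * (b * d - a * c); 2 * (c * d + a * b); a * a - b * b - c * c + d * d]]
    i) j); last by apply/funext => t; rewrite mxE.
have i0 : (inord 0 : 'I_3) = 0%N :> nat by exact: inordK.
have i1 : (inord 1 : 'I_3) = 1%N :> nat by exact: inordK.
have i2 : (inord 2 : 'I_3) = 2%N :> nat by exact: inordK.
rewrite !mxE i0 i1 i2 {i0 i1 i2} /=.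
move: i j => [i ilt] [j jlt] /=.
move: i ilt j jlt => [|[|[|i]]] ilt; last case: (notF ilt).
all: move=> [|[|[|j]]] jlt; last case: (notF jlt).
all: rewrite /=; (eapply eqd;
  [repeat first [exact: da|exact: db|exact: dc|exact: dd|exact: d2|
     eapply dM|eapply dN|eapply dD] | rewrite /=; ring]).
Qed.

Lemma crosspE (R : realType) (x y : 'cV[R]_3) (i : 'I_3) :
  crossp x y i 0 = nth 0
    [:: x (inord 1) 0 * y (inord 2) 0 - x (inord 2) 0 * y (inord 1) 0;
        x (inord 2) 0 * y (inord 0) 0 - x (inord 0) 0 * y (inord 2) 0;
        x (inord 0) 0 * y (inord 1) 0 - x (inord 1) 0 * y (inord 0) 0] i.
Proof.
rewrite mxE -!val_eqE /= !inordK//.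
by case: i => [[|[|[|//]]]].
Qed.

Lemma rolling_velocityE (R : realType) (gamma : R -> 'cV[R]_2) (K s : R) (i : 'I_3) :
  rolling_velocity gamma K s i 0 =
  nth 0 [:: - K * derive1 gamma s 1 0; K * derive1 gamma s 0 0; 0] i.
Proof.
set g := derive1 gamma s.
have i0 : (inord 0 : 'I_3) = lshift 1 (0 : 'I_2).
  by apply: ord_inj; rewrite /= inordK.
have i1 : (inord 1 : 'I_3) = lshift 1 (1 : 'I_2).
  by apply: ord_inj; rewrite /= inordK.
have i2 : (inord 2 : 'I_3) = rshift 2 (0 : 'I_1).
  by apply: ord_inj; rewrite /= inordK.
have e0 : embed_plane g (inord 0) 0 = g 0 0 by rewrite i0; exact: col_mxEu.
have e1 : embed_plane g (inord 1) 0 = g 1 0 by rewrite i1; exact: col_mxEu.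
have e2 : embed_plane g (inord 2) 0 = 0.
  by rewrite i2; apply: etrans (col_mxEd _ _ _ _) _; rewrite mxE.
rewrite mxE crosspE e0 e1 e2 !mxE -!val_eqE /= !inordK//=.
by case: i => [[|[|[|//]]]] ? /=; ring.
Qed.

(** The rolling velocity is [K] times the tangent turned by a right angle. The divisions by 2
    compensate for the doubling of the angular velocity between spinors and rotations. *)
Lemma rolling_motion_spinor (R : realType) (K : R) (gamma : R -> 'cV[R]_2)
    (x : R -> quaternion R) :
  spinor_motion K (fun s => - (derive1 gamma s 1 0) / 2)
    (fun s => derive1 gamma s 0 0 / 2) x ->
  x 0 = quat1 R ->
  rolling_motion gamma K (fun s => rotation_mx (x s)).
Proof.
move=> xm x0.
have xd s i j := rotation_mx_derive s i j xm.
have Ad s : derivable (fun s => rotation_mx (x s)) s 1.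
  by apply/derivable_mxP => i j; case: (xd s i j).
split => // [s|s w|].
- exact/rotation_mx_is_rotation/(spinor_motion_unit xm x0).
- apply/matrixP => i k; rewrite (ord1 k) derive1E derive_mx// crosspE.
  rewrite !rolling_velocityE !inordK//=.
  pose u := derive1 gamma s; pose A := rotation_mx (x s).
  rewrite mxE (eq_bigr (fun j => nth 0
    [:: 2 * K * (u 0 0 / 2) * A (inord 2) j;
        - (2 * K * (- u 1 0 / 2) * A (inord 2) j);
        2 * K * ((- u 1 0 / 2) * A (inord 1) j - (u 0 0 / 2) * A (inord 0) j)] i *
    w j 0)); last first.
    by move=> j _; rewrite mxE; case: (xd s i j) => _ ->.
  have E k' : (A *m w) k' 0 = \sum_j A k' j * w j 0 by rewrite mxE.
  rewrite !E !big_ord_recl !big_ord0.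
  by case: i => [[|[|[|//]]]] ? /=; field.
- by rewrite /= x0 rotation_mx_quat1.
Qed.

(** * Application to the path *)

Theorem theorem3 (R : realType) (gamma : R -> 'cV[R]_2) (L : R)
    (v : 'cV[R]_2) (hT : periodic_path gamma L v) :
  exists N : nat, forall n : nat, (N <= n)%N -> admits_trajectoid gamma L n.
Proof.
case: hT => -[gd gdd] g1 [L0 v0 gL].
pose p s := - derive1 gamma s 1 0 / 2; pose r s := derive1 gamma s 0 0 / 2.
pose P s := - gamma s 1 0 / 2; pose Q s := gamma s 0 0 / 2.
have gid i s : is_derive s (1 : R) (fun t => gamma t i 0) (derive1 gamma s i 0).
  apply: DeriveDef; first by have /derivable_mxP := gd s; apply.
  by rewrite derive1E derive_mx// mxE.
have Pd s : is_derive s (1 : R) P (p s).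
  have ? := gid 1 s.
  rewrite (_ : P = (- 2^-1) \*: (fun t => gamma t 1 0)); last first.
    by apply/funext => t; rewrite /P mulrC mulrN -mulNr.
  by apply: is_derive_eq; rewrite /p/= mulrC mulrN -mulNr.
have Qd s : is_derive s (1 : R) Q (r s).
  have ? := gid 0 s.
  rewrite (_ : Q = 2^-1 \*: (fun t => gamma t 0 0)); last first.
    by apply/funext => t; rewrite /Q mulrC.
  by apply: is_derive_eq; rewrite /r/= mulrC.
have gc i : continuous (fun s => derive1 gamma s i 0).
  move=> s; apply: differentiable_continuous; apply/derivable1_diffP.
  by have /derivable_mxP := gdd s; apply.
have pc : continuous p.
  by move=> s; apply: cvgM; [apply: cvgN; exact: gc|exact: cvg_cst].
have rc : continuous r by move=> s; apply: cvgM; [exact: gc|exact: cvg_cst].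
have gle i s : `|derive1 gamma s i 0| <= 1.
  rewrite -[_ <= 1](@ler_sqr R) ?nnegrE// expr1n real_normK ?num_real//.
  have : \sum_(i < 2) derive1 gamma s i 0 ^+ 2 = 1.
    have := g1 s; rewrite /enorm => /(congr1 (fun t => t ^+ 2)).
    by rewrite sqr_sqrtr ?expr1n// sumr_ge0// => j _; exact: sqr_ge0.
  move=> <-; rewrite (bigD1 i)//= lerDl.
  by apply: sumr_ge0 => j _; exact: sqr_ge0.
have p1 s : `|p s| <= 1.
  have := gle 1 s; rewrite !ler_norml /p => /andP[? ?]; apply/andP; split; lra.
have r1 s : `|r s| <= 1.
  have := gle 0 s; rewrite !ler_norml /r => /andP[? ?]; apply/andP; split; lra.
have dL i s : derive1 gamma (s + L) i 0 = derive1 gamma s i 0.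
  have := is_derive_translate (gid i (s + L)).
  rewrite (_ : (fun t => _) = (fun t => gamma t i 0) + cst (v i 0)); last first.
    by apply/funext => t; rewrite gL mxE.
  case=> _ <-; have ? := gid i s.
  by rewrite derive_val addr0.
have pL s : p (s + L) = p s by rewrite /p dL.
have rL s : r (s + L) = r s by rewrite /r dL.
(* The increment of [(P, Q)] over one period is half of [v] turned by a right angle. *)
have PQ : (P L, Q L) != (P 0, Q 0).
  have gL0 i : gamma L i 0 = gamma 0 i 0 + v i 0.
    by rewrite -[X in gamma X]add0r gL mxE.
  apply: contra v0 => /eqP[]; rewrite /P /Q !gL0 => e1 e0.
  apply/eqP/matrixP => i j; rewrite (ord1 j) mxE.
  have /orP[/eqP->|/eqP->] : (i == 0) || (i == 1).
  - by case: i => [[|[|//]]] ?.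
  - by lra.
  - by lra.
have [N _ HN] := spinor_motion_angle pc rc p1 r1 Pd Qd L0 PQ.
(* The bound 2 places [pi / n] strictly between 0 and [pi], where the sine is nonzero, as the
   half-turn recurrence requires. *)
exists (maxn N 2) => n; rewrite geq_max => /andP[Nn n2].
have n0 : (0 < n)%N by exact: ltn_trans n2.
split => //.
have [K K0 [x xm [x0 xL]]] := HN n Nn.
exists K => //; exists (fun s => rotation_mx (x s)).
  exact: rolling_motion_spinor.
move=> s; rewrite /sphere_trace (spinor_motion_period pL rL xm x0 xL).
- by rewrite rotation_mx_opp.
- rewrite gt_eqF//; apply: sin_gt0_pi.
  rewrite divr_gt0 ?pi_gt0 ?ltr0n//=.
  by rewrite ltr_pdivrMr ?ltr0n// ltr_pMr ?pi_gt0// ltr1n.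
- by rewrite mulrC divfK// pnatr_eq0 -lt0n.
Qed.
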